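(* For every integer $m \ge 1$, the $R_4$-free digraph on $m$ vertices that maximizes $\|d^+_D\|_2^2$ is unique up to isomorphism and is isomorphic to $E(m)$ (i.e. $E(m)$ is $R_4$-free and attains the maximum, and every $R_4$-free digraph on $m$ vertices attaining the maximum is isomorphic to $E(m)$). Consequently, writing $m = 3q + r$ with $r \in \{0,1,2\}$ and $q \ge 0$ an integer: \begin{itemize} \item if $r = 0$, then $\mathrm{ex}^+_{L_2}(m, R_4) = 12q^3$; \item if $r = 1$, then $\mathrm{ex}^+_{L_2}(m, R_4) = 12q^3 + 12q^2 + 3q$; \item if $r = 2$, then $\mathrm{ex}^+_{L_2}(m, R_4) = 12q^3 + 24q^2 + 14q + 2$. \end{itemize}
   Context: Digraphs are finite, loopless, and have no multiple arcs in the same direction; 2-cycles (arcs in both directions between a pair of vertices) are permitted. $d^+_D(v)$ denotes the out-degree of $v$ in $D$, and $\|d^+_D\|_2^2 = \sum_{v \in V(D)} d^+_D(v)^2$. A digraph is $H$-free if it contains no (not necessarily induced) subdigraph isomorphic to $H$. The $L_2$ Turán number is $$\mathrm{ex}^+_{L_2}(m,H) = \max\Big\{ \sum_{v\in V(D)} d^+_D(v)^2 : |V(D)| = m,\ D \text{ is } H\text{-free}\Big\}.$$ $R_4$ is the unique strongly connected tournament on four vertices; it has out-degree sequence $(1,1,2,2)$ and is given explicitly by vertices $u_1,u_2,u_3,u_4$ and arcs $u_1u_2, u_2u_3, u_3u_4, u_4u_1, u_1u_3, u_2u_4$. $TT_j$ is the transitive tournament on $j$ vertices ($TT_0$ is empty).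 $T_3(k)$ is the complete 3-partite directed Turán graph on $k$ vertices: the vertex set is partitioned into 3 parts with sizes as equal as possible (any two sizes differ by at most 1, parts may be empty), there are no arcs within parts, and for any two vertices in different parts both arcs between them are present. The digraph $E(m)$ is the disjoint union of $T_3(k)$ and $TT_{m-k}$ together with all arcs directed from each vertex of $T_3(k)$ to each vertex of $TT_{m-k}$ (and no arcs in the reverse direction), where $k = m$ if $m \equiv 0$ or $2 \pmod 3$, and $k = m-1$ if $m \equiv 1 \pmod 3$. *)

(* Defs.v *)
From HB Require Import structures.
From mathcomp Require Import all_boot.

Set Implicit Arguments.
Unset Strict Implicit.
Unset Printing Implicit Defensive.

Record digraph := Digraph {
  vertex :> finType;
  has_arc : rel vertex;
  arc_irr : irreflexive has_arc }.

Definition nvertices (D : digraph) : nat := #|{: D}|.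

Definition outdeg (D : digraph) (v : D) : nat := #|[set w | has_arc v w]|.

Definition outdeg_sqnorm (D : digraph) : nat := \sum_(v : D) outdeg v ^ 2.

Definition isomorphic (D D' : digraph) : Prop :=
  exists2 f : D -> D',
    bijective f & forall x y : D, has_arc (f x) (f y) = has_arc x y.

(* Arcs of H must be preserved, non-arcs need not be: the copy of H in D is
   not required to be induced. *)
Definition contains (D H : digraph) : bool :=
  [exists f : {ffun H -> D},
     injectiveb f && [forall x, forall y, has_arc x y ==> has_arc (f x) (f y)]].

Definition is_free (H D : digraph) : bool := ~~ contains D H.

(* Pairs (x, x) in A are discarded, so that every A yields a digraph, and every
   digraph on the vertex set T arises in this way. *)
Definition digraph_of_rel (T : finType) (A : {set T * T}) : rel T :=
  fun x y => (x != y) && ((x, y) \in A).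

Lemma digraph_of_irr (T : finType) (A : {set T * T}) :
  irreflexive (digraph_of_rel A).
Proof. by move=> x; rewrite /digraph_of_rel eqxx. Qed.

Definition digraph_of (T : finType) (A : {set T * T}) : digraph :=
  Digraph (digraph_of_irr A).

(* Up to isomorphism, the digraphs of order m are those on 'I_m. *)
Definition exL2 (m : nat) (H : digraph) : nat :=
  \max_(A : {set 'I_m * 'I_m} | is_free H (digraph_of A))
     outdeg_sqnorm (digraph_of A).

Definition extremal (H D : digraph) : Prop :=
  is_free H D /\
  forall D' : digraph, nvertices D' = nvertices D -> is_free H D' ->
    outdeg_sqnorm D' <= outdeg_sqnorm D.

(* The vertex u_i is i.-1 : 'I_4. *)
Definition R4_rel : rel 'I_4 := fun x y =>
  (val x, val y) \in [:: (0, 1); (1, 2); (2, 3); (3, 0); (0, 2); (1, 3)].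

Lemma R4_irr : irreflexive R4_rel.
Proof. by case; do 4?case. Qed.

Definition R4 : digraph := Digraph R4_irr.

Definition TT_rel (j : nat) : rel 'I_j := fun x y => x < y.

Lemma TT_irr (j : nat) : irreflexive (@TT_rel j).
Proof. by move=> x; rewrite /TT_rel ltnn. Qed.

Definition TT (j : nat) : digraph := Digraph (@TT_irr j).

(* The parts are the residue classes modulo 3 in 'I_k; their sizes differ by at
   most 1. *)
Definition T3_rel (k : nat) : rel 'I_k := fun x y => x %% 3 != y %% 3.

Lemma T3_irr (k : nat) : irreflexive (@T3_rel k).
Proof. by move=> x; rewrite /T3_rel eqxx. Qed.

Definition T3 (k : nat) : digraph := Digraph (@T3_irr k).

Definition djoin_rel (D1 D2 : digraph) : rel (D1 + D2)%type := fun x y =>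
  match x, y with
  | inl a, inl b => has_arc a b
  | inr a, inr b => has_arc a b
  | inl _, inr _ => true
  | inr _, inl _ => false
  end.

Lemma djoin_irr (D1 D2 : digraph) : irreflexive (@djoin_rel D1 D2).
Proof. by case=> x /=; apply: arc_irr. Qed.

Definition djoin (D1 D2 : digraph) : digraph := Digraph (@djoin_irr D1 D2).

Definition E (m : nat) : digraph :=
  let k := if m %% 3 == 1 then m.-1 else m in
  djoin (T3 k) (TT (m - k)).

(* Main.v *)
From Stdlib Require Import ZArith.
Require Import Defs.
From HB Require Import structures.
From mathcomp Require Import all_boot.
From mathcomp Require Import zify.

(** The upper bound comes from Zykov symmetrization, used in a form that also
    settles uniqueness. Since [R4] is a tournament, replacing a vertex by a
    copy of a vertex that is not adjacent to it creates no [R4]. The squared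
    out-degree norm is convex along such a move: replacing [u] by a copy of [v]
    and replacing [v] by a copy of [u] change the norm by amounts whose sum is
    twice the number of vertices dominating exactly one of [u] and [v]. Hence
    in an extremal digraph nonadjacent vertices have the same in-neighbourhood
    and the same out-degree ([extremal_twins]), and nonadjacency is an
    equivalence relation ([extremal_classes]).

    One representative of each class gives a semicomplete digraph without
    [R4], that is, without a 4-cycle, because the two chords of a 4-cycle always
    complete it to [R4] ([R4_free_no_4cycle]). A strong semicomplete digraph on
    four or more vertices has a 4-cycle ([strong_4cycle]), so the initial strong
    component of the representatives has at most three vertices. Let each vertex
    copy its representative, which changes no out-degree. Then some classes, at
    most three, of sizes [a], [b], [c], receive no arc from the remaining [j]
    vertices ([extremal_colouring]). A vertex in a class of size
    [a] has out-degree at most [m - a], and the out-degrees of the remaining [j]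
    vertices are those of an [R4]-free digraph of order [j]. By induction on
    the order, with [h x = x * (m - x) ^ 2], the norm is at most
    [h a + h b + h c + R4_bound j].

    It remains to maximize that expression when [a + b + c + j = m]
    ([parts_bound]). For a fixed sum [a + b + c] the best choice is a balanced
    one, because [h] lies below its secant through two consecutive integers, and
    then the nine cases modulo 3 are polynomial inequalities whose differences
    have nonnegative coefficients. When equality holds the class sizes are those
    of [E m] and each out-degree bound is attained, which determines the arcs
    ([extremal_step]). *)

Set Implicit Arguments.
Unset Strict Implicit.
Unset Printing Implicit Defensive.

(** * The extremal value and its maximality *)

Definition R4_bound (m : nat) : nat :=
  let q := m %/ 3 in
  match m %% 3 with
  | 0 => 12 * q ^ 3
  | 1 => 12 * q ^ 3 + 12 * q ^ 2 + 3 * q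
  | _ => 12 * q ^ 3 + 24 * q ^ 2 + 14 * q + 2
  end.

Lemma R4_bound0 q : R4_bound (3 * q) = 12 * q ^ 3.
Proof. by rewrite /R4_bound mulKn // modnMr. Qed.

Lemma R4_bound1 q :
  R4_bound (3 * q + 1) = 12 * q ^ 3 + 12 * q ^ 2 + 3 * q.
Proof.
rewrite /R4_bound; have -> : (3 * q + 1) %/ 3 = q by lia.
by have -> : (3 * q + 1) %% 3 = 1 by lia.
Qed.

Lemma R4_bound2 q :
  R4_bound (3 * q + 2) = 12 * q ^ 3 + 24 * q ^ 2 + 14 * q + 2.
Proof.
rewrite /R4_bound; have -> : (3 * q + 2) %/ 3 = q by lia.
by have -> : (3 * q + 2) %% 3 = 2 by lia.
Qed.

Lemma mod3P n : exists q, [\/ n = 3 * q, n = 3 * q + 1 | n = 3 * q + 2].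
Proof.
exists (n %/ 3); have := ltn_pmod n (isT : 0 < 3); have := divn_eq n 3.
rewrite mulnC; case: (n %% 3) => [|[|[|//]]] nE _; rewrite ?addn0 in nE;
  by [constructor 1|constructor 2|constructor 3].
Qed.

(** The contribution to the norm of a part of size [x], in a digraph of order
    [m], when each vertex of the part dominates everything outside the part. *)
Definition parts_weight m x := x * (m - x) ^ 2.

Lemma parts_weightD x y : parts_weight (x + y) x = x * y ^ 2.
Proof. by rewrite /parts_weight addKn. Qed.

(** With [n] the order of the three parts, [R4_bound m - F] grows like
    [n * j ^ 2], so only bounded [j] can give equality. *)
Lemma balanced_bound p r j : r < 3 -> 0 < 3 * p + r ->
  let m := 3 * p + r + j in
  let F := (3 - r) * parts_weight m p + r * parts_weight m (p + 1)
           + R4_bound j in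
  F <= R4_bound m /\
  (F = R4_bound m -> m = 1 \/ r = 0 /\ j <= 1 \/ r = 2 /\ j = 0).
Proof.
move=> r3 k0 m F.
suff [d FE dE] : exists2 d, R4_bound m = F + d &
    d = 0 -> m = 1 \/ r = 0 /\ j <= 1 \/ r = 2 /\ j = 0.
  by split=> [|Fm]; [rewrite FE leq_addr | apply: dE; lia].
have -> : F = (3 - r) * (p * (2 * p + r + j) ^ 2)
              + r * ((p + 1) * (2 * p + r.-1 + j) ^ 2) + R4_bound j.
  have m1 : m = p + (2 * p + r + j) by lia.
  rewrite /F {1}m1 parts_weightD; case: (posnP r) => [->//|r0].
  have m2 : m = p + 1 + (2 * p + r.-1 + j) by lia.
  by rewrite {1}m2 parts_weightD.
(* Each witness below is R4_bound m - F, expanded in p and s = j %/ 3. *)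
rewrite {F}/m {m}; have [s [->|->|->]] := mod3P j;
  case: r r3 k0 => [|[|[|//]]] _ k0; rewrite [_.-1]/= ?subSS subn0.
- exists (9 * p * s ^ 2);
    last by move/eqP; rewrite !(addn_eq0, muln_eq0, expn_eq0) /=; lia.
  by rewrite (_ : 3 * p + 0 + 3 * s = 3 * (p + s)) ?R4_bound0; lia.
- exists (3 * s + 3 * s ^ 2 + p + 9 * p * s ^ 2); last by nia.
  by rewrite (_ : _ + 3 * s = 3 * (p + s) + 1) ?R4_bound0 ?R4_bound1; lia.
- exists (2 * s + 6 * s ^ 2 + 9 * p * s ^ 2); last by nia.
  by rewrite (_ : _ + 3 * s = 3 * (p + s) + 2) ?R4_bound0 ?R4_bound2; lia.
- exists (6 * p * s + 9 * p * s ^ 2);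
    last by move/eqP; rewrite !(addn_eq0, muln_eq0, expn_eq0) /=; lia.
  by rewrite (_ : 3 * p + 0 + _ = 3 * (p + s) + 1) ?R4_bound1; lia.
- exists (1 + 5 * s + 3 * s ^ 2 + p + 6 * p * s + 9 * p * s ^ 2); last by nia.
  by rewrite (_ : 3 * p + 1 + _ = 3 * (p + s) + 2) ?R4_bound1 ?R4_bound2; lia.
- exists (4 + 9 * s + 6 * s ^ 2 + 3 * p + 6 * p * s + 9 * p * s ^ 2);
    last by nia.
  by rewrite (_ : 3 * p + 2 + _ = 3 * (p + s + 1)) ?R4_bound1 ?R4_bound0; lia.
- exists (2 * p + 12 * p * s + 9 * p * s ^ 2); last by nia.
  by rewrite (_ : 3 * p + 0 + _ = 3 * (p + s) + 2) ?R4_bound2; lia.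
- exists (6 + 10 * s + 3 * s ^ 2 + 6 * p + 12 * p * s + 9 * p * s ^ 2);
    last by nia.
  by rewrite (_ : 3 * p + 1 + _ = 3 * (p + s + 1)) ?R4_bound2 ?R4_bound0; lia.
- exists (7 + 13 * s + 6 * s ^ 2 + 5 * p + 12 * p * s + 9 * p * s ^ 2);
    last by nia.
  by rewrite (_ : 3 * p + 2 + _ = 3 * (p + s + 1) + 1) ?R4_bound2 ?R4_bound1;
    lia.
Qed.

(** The cubic [x * (m - x) ^ 2] minus its secant through [p] and [p + 1] is a
    monic cubic with roots [p] and [p + 1]; the third root follows because the
    roots of the difference sum to [2 * m]. *)
Lemma secant_gap (m p x : Z) :
  (x * (m - x) ^ 2 = p * (m - p) ^ 2
    + (x - p) * ((p + 1) * (m - (p + 1)) ^ 2 - p * (m - p) ^ 2)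
    - (x - p) * (x - p - 1) * (2 * m - 2 * p - 1 - x))%Z.
Proof. ring. Qed.

Lemma secant_gap_ge0 (m p x : Z) :
  (0 <= p -> 3 * p <= m -> 1 <= m -> 0 <= x <= m ->
   0 <= (x - p) * (x - p - 1) * (2 * m - 2 * p - 1 - x))%Z.
Proof.
move=> p0 pm m1 xm; apply: Z.mul_nonneg_nonneg; last by lia.
by case: (Z_le_gt_dec x p) => ?; nia.
Qed.

Lemma secant_gap_eq0 (m p x : Z) :
  ((x - p) * (x - p - 1) * (2 * m - 2 * p - 1 - x) = 0 ->
   x = p \/ x = p + 1 \/ x = 2 * m - 2 * p - 1)%Z.
Proof. by rewrite !Z.mul_eq_0; lia. Qed.

(** Summing the secant bound over the three parts replaces the weights by an
    affine function of [a + b + c], whose value is that of the balanced sizes.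
    The third root of the gap is incompatible with the sum, except for sizes
    that are balanced anyway. *)
Lemma parts_balance m p r a b c : r < 3 -> a + b + c = 3 * p + r ->
  0 < m -> a + b + c <= m ->
  let F := parts_weight m a + parts_weight m b + parts_weight m c in
  let G := (3 - r) * parts_weight m p + r * parts_weight m (p + 1) in
  F <= G /\ (F = G -> c <= b <= a ->
             [/\ a = p + (0 < r), b = p + (1 < r) & c = p]).
Proof.
move=> r3 abc m0 km F G; set zp := Z.of_nat p; set zm := Z.of_nat m.
have wE x : x <= m ->
    Z.of_nat (parts_weight m x) = (Z.of_nat x * (zm - Z.of_nat x) ^ 2)%Z.
  by rewrite /zm => /subnKC <-; rewrite parts_weightD; lia.
pose gap (x : nat) := let z := Z.of_nat x in
  ((z - zp) * (z - zp - 1) * (2 * zm - 2 * zp - 1 - z))%Z.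
have gap0 x : x <= m -> (0 <= gap x)%Z.
  by move=> xm; apply: secant_gap_ge0; lia.
have gapP x : gap x = 0%Z -> x = p \/ x = p + 1 \/ x + 2 * p + 1 = 2 * m.
  by move=> /secant_gap_eq0; lia.
have gapE x : x <= m -> Z.of_nat (parts_weight m x) =
    (Z.of_nat (parts_weight m p)
     + (Z.of_nat x - zp) * (Z.of_nat (parts_weight m (p + 1))
                            - Z.of_nat (parts_weight m p))
     - gap x)%Z.
  move=> xm.
  by rewrite !wE ?Nat2Z.inj_add; [exact: secant_gap | lia..].
have total : (Z.of_nat F + gap a + gap b + gap c = Z.of_nat G)%Z.
  rewrite /F /G !Nat2Z.inj_add (Nat2Z.inj_mul (3 - r)) (Nat2Z.inj_mul r).
  rewrite (gapE a) ?(gapE b) ?(gapE c); [|lia..].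
  have -> : Z.of_nat a = (3 * zp + Z.of_nat r - Z.of_nat b - Z.of_nat c)%Z.
    by lia.
  by rewrite Nat2Z.inj_sub; [ring | lia].
have := gap0 a; have := gap0 b; have := gap0 c.
have := gapP a; have := gapP b; have := gapP c.
move: (gap a) (gap b) (gap c) total => ga gb gc total; clearbody F G.
move=> Pc Pb Pa c0 b0 a0; split; first by lia.
by move=> FG cba; split; lia.
Qed.

(** The size of the [i]-th part of [T3 k], where [k] is the order of the
    3-partite piece of [E m]. *)
Definition E_part m i := (m - (m %% 3 == 1) + 2 - i) %/ 3.

Lemma R4_bound_E m :
  parts_weight m (E_part m 0) + parts_weight m (E_part m 1)
    + parts_weight m (E_part m 2) = R4_bound m.
Proof.
have [q [->|->|->]] := mod3P m; rewrite ?R4_bound0 ?R4_bound1 ?R4_bound2.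
- have P i : i < 3 -> E_part (3 * q) i = q by rewrite /E_part; lia.
  by rewrite !P // (_ : 3 * q = q + (2 * q)) ?parts_weightD; lia.
- have P i : i < 3 -> E_part (3 * q + 1) i = q by rewrite /E_part; lia.
  by rewrite !P // (_ : 3 * q + 1 = q + (2 * q + 1)) ?parts_weightD; lia.
- have P i : i < 2 -> E_part (3 * q + 2) i = q + 1 by rewrite /E_part; lia.
  have P2 : E_part (3 * q + 2) 2 = q by rewrite /E_part; lia.
  rewrite (P 0) // (P 1) // P2.
  rewrite {1 2}(_ : 3 * q + 2 = q + 1 + (2 * q + 1)) ?parts_weightD;
    last by lia.
  by rewrite (_ : 3 * q + 2 = q + (2 * q + 2)) ?parts_weightD; lia.
Qed.

(** For [m = 1] equality also holds for the sizes [1, 0, 0] with [j = 0],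
    another description of the digraph with one vertex. *)
Lemma parts_bound a b c j : 0 < a + b + c ->
  let m := a + b + c + j in
  let F := parts_weight m a + parts_weight m b + parts_weight m c
           + R4_bound j in
  F <= R4_bound m /\
  (F = R4_bound m -> c <= b <= a -> m != 1 ->
    [/\ a = E_part m 0, b = E_part m 1 & c = E_part m 2]).
Proof.
move=> abc0 m F.
have [p pE] : exists p, a + b + c = 3 * p + (a + b + c) %% 3.
  by exists ((a + b + c) %/ 3); rewrite {1}(divn_eq (a + b + c) 3) mulnC.
have r3 : (a + b + c) %% 3 < 3 by rewrite ltn_mod.
move: (_ %% _) pE r3 => r pE r3.
have m0 : 0 < m by lia.
have km : a + b + c <= m by lia.
have [le1 eq1] := parts_balance r3 pE m0 km.
have k0 : 0 < 3 * p + r by lia.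
have := balanced_bound j r3 k0; rewrite -pE -/m => -[le2 eq2].
split=> [|FE cba m1]; first by rewrite /F; lia.
have [|aE bE cE] := eq1 _ cba; first by rewrite /F in FE; lia.
have rj : r = 0 /\ j <= 1 \/ r = 2 /\ j = 0.
  by case: eq2 => [|/eqP|//]; [rewrite /F in FE; lia | rewrite (negPf m1)].
have mE : m = 3 * p + r + j by rewrite -pE.
by rewrite /E_part; clearbody m; split; lia.
Qed.

(** * Strong semicomplete digraphs *)

Definition semicomplete_on (T : finType) (e : rel T) (K : {set T}) :=
  {in K &, forall x y, x != y -> e x y || e y x}.

(** Strong connectivity of [K], stated by cuts so that no paths are needed. *)
Definition strong_on (T : finType) (e : rel T) (K : {set T}) :=
  forall X : {set T}, X \proper K -> X != set0 ->
  exists x y, [/\ x \in X, y \in K, y \notin X & e y x].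

Definition has_4cycle (T : finType) (e : rel T) (K : {set T}) :=
  exists x y z w,
  [/\ [/\ x \in K, y \in K, z \in K & w \in K], uniq [:: x; y; z; w]
    & [/\ e x y, e y z, e z w & e w x]].

(** Fix [x]. If no arc leads from an out-neighbour of [x] to a different
    in-neighbour of [x], then no arc enters the set of [x] and its
    in-neighbours, and none enters the set of the other vertices that [x] does
    not dominate. By the cut condition the first set is everything and the
    second is empty: every other vertex is joined to [x] in both directions,
    and any arc between two of them closes a triangle. *)
Lemma strong_triangle (T : finType) (e : rel T) (K : {set T}) :
  semicomplete_on e K -> strong_on e K -> 2 < #|K| ->
  exists x y z, [/\ [/\ x \in K, y \in K & z \in K],
    [/\ x != y, y != z & z != x] & [/\ e x y, e y z & e z x]].
Proof.
move=> tot cut K3.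
have [x xK] : exists x, x \in K by apply/card_gt0P; lia.
case: (boolP [exists y in K :\ x, exists z in K :\ x,
               [&& y != z, e x y, e y z & e z x]]) => [|noT].
  case/exists_inP=> y; rewrite !inE => /andP[yx yK] /exists_inP[z].
  rewrite !inE => /andP[zx zK] /and4P[yz xy Eyz Ezx].
  by exists x, y, z; rewrite eq_sym in yx.
have noT' y z : y \in K -> z \in K -> y != x -> z != x -> y != z ->
    e x y -> e z x -> ~~ e y z.
  move=> yK zK yx zx yz xy Ezx; apply: contra noT => Eyz.
  apply/exists_inP; exists y; rewrite ?inE ?yx //.
  by apply/exists_inP; exists z; rewrite ?inE ?zx // yz xy Eyz.
(* The two cuts of the argument, one for each direction. *)
have both y : y \in K -> y != x -> e x y && e y x.
  move=> yK yx; case: (boolP (e x y)) => xy.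
    apply/contraT => /= nyx.
    pose X := [set z in K | (z == x) || e z x].
    case: (cut X).
    - apply/properP; split; first by apply/subsetP => z; rewrite inE => /andP[].
      by exists y; rewrite // inE yK (negPf yx) (negPf nyx).
    - by apply/set0Pn; exists x; rewrite inE xK eqxx.
    move=> z [w []]; rewrite !inE => /andP[zK zX] wK; rewrite wK negb_or /=.
    case/andP=> wx nwx wz; case: (eqVneq z x) zX wz => [->|zx /= zX wz].
      by rewrite (negPf nwx).
    have xw : e x w by have := tot w x wK xK wx; rewrite (negPf nwx).
    have wNz : w != z by apply: contraNneq nwx => ->.
    by have := noT' w z wK zK wx zx wNz xw zX; rewrite wz.
  apply/contraT => _.
  pose X := [set z in K | (z != x) && ~~ e x z].
  case: (cut X).
  - apply/properP; split; first by apply/subsetP => z; rewrite inE => /andP[].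
    by exists x; rewrite // inE xK eqxx.
  - by apply/set0Pn; exists y; rewrite inE yK yx xy.
  move=> z [w []]; rewrite !inE => /and3P[zK zx nxz] wK; rewrite wK /=.
  rewrite negb_and !negbK => wX wz.
  case: (eqVneq w x) wX wz => [->|wx /= xw wz].
    by rewrite (negPf nxz).
  have zEx : e z x.
    by have := tot x z xK zK; rewrite eq_sym zx (negPf nxz) => /(_ isT).
  have wNz : w != z by apply: contraNneq nxz => <-.
  by have := noT' w z wK zK wx zx wNz xw zEx; rewrite wz.
have /card_gt1P[y [z []]] : 1 < #|K :\ x|.
  by have := cardsD1 x K; rewrite xK; lia.
rewrite !inE => /andP[yx yK] /andP[zx zK] yz.
have /andP[xy Eyx] := both y yK yx; have /andP[xz Ezx] := both z zK zx.
case/orP: (tot y z yK zK yz) => E1.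
  by exists x, y, z; rewrite eq_sym in yx.
by exists x, z, y; split; split; rewrite // eq_sym.
Qed.

(** Take a triangle. If a vertex outside it both receives and sends an arc to
    it, two of these arcs are consecutive along the triangle, and inserting the
    vertex there gives a 4-cycle. Otherwise the outside vertices split into the
    set [B] of those dominated by the whole triangle and the set [W :\: B] of
    those dominating it, and strong connectivity forces an arc from [B] to
    [W :\: B], which closes a 4-cycle through two triangle vertices. *)
Lemma strong_4cycle (T : finType) (e : rel T) (K : {set T}) :
  semicomplete_on e K -> strong_on e K -> 3 < #|K| -> has_4cycle e K.
Proof.
move=> tot cut K4.
have [x [y [z [[xK yK zK] [xy yz zx] [Exy Eyz Ezx]]]]] :=
  strong_triangle tot cut (ltnW K4).
pose W := [set w in K | w \notin [:: x; y; z]].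
case: (boolP [exists w in W, (e x w || e y w || e z w) &&
                             (e w x || e w y || e w z)]) => [|noW].
  case/exists_inP=> w; rewrite !inE !negb_or => /and4P[wK wx wy wz].
  have := tot w x wK xK wx; have := tot w y wK yK wy.
  have := tot w z wK zK wz.
  have c1 : e x w -> e w y -> has_4cycle e K.
    move=> xw wy'; exists x, w, y, z; split => //=.
    by rewrite !inE !negb_or wy wz yz xy !andbT eq_sym wx eq_sym zx.
  have c2 : e y w -> e w z -> has_4cycle e K.
    move=> yw wz'; exists y, w, z, x; split => //=.
    by rewrite !inE !negb_or wx wz yz zx !andbT eq_sym wy eq_sym xy.
  have c3 : e z w -> e w x -> has_4cycle e K.
    move=> zw wx'; exists z, w, x, y; split => //=.
    by rewrite !inE !negb_or wx wy xy zx !andbT eq_sym wz eq_sym yz.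
  move: c1 c2 c3; case: (e x w); case: (e y w); case: (e z w);
  case: (e w x); case: (e w y); case: (e w z) => //= c1 c2 c3 _ _ _ _;
  by [apply: c1 | apply: c2 | apply: c3].
pose B := [set w in W | [|| e x w, e y w | e z w]].
have BE w t : w \in B -> t \in [:: x; y; z] -> ~~ e w t.
  rewrite inE orbA => /andP[wW wB] tt; apply: contra noW => wt.
  apply/exists_inP; exists w => //; rewrite wB.
  by move: tt; rewrite !inE => /or3P[]/eqP<-; rewrite wt ?orbT.
have AE w t : w \in W :\: B -> t \in [:: x; y; z] -> ~~ e t w.
  rewrite [w \in _]inE => /andP[wB wW]; move: wB; rewrite inE wW /= !negb_or.
  by move=> /and3P[? ? ?]; rewrite !inE => /or3P[]/eqP->.
have WK w : w \in W -> w \in K by rewrite inE => /andP[].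
have Wt w t : w \in W -> t \in [:: x; y; z] -> w != t.
  by rewrite inE => /andP[_ wt] tt; apply: contraNneq wt => ->.
have KE w : w \in K -> (w \in [:: x; y; z]) || (w \in W).
  by move=> wK; rewrite [w \in W]inE wK orbN.
have tK t : t \in [:: x; y; z] -> t \in K.
  by rewrite !inE => /or3P[]/eqP->.
have At w t : w \in W :\: B -> t \in [:: x; y; z] -> e w t.
  move=> wA tt; have wW : w \in W by move: wA; rewrite inE => /andP[].
  have := tot w t (WK _ wW) (tK _ tt) (Wt _ _ wW tt).
  by rewrite (negPf (AE _ _ wA tt)) orbF.
have Bt w t : w \in B -> t \in [:: x; y; z] -> e t w.
  move=> wB tt; have wW : w \in W by move: wB; rewrite inE => /andP[].
  have := tot w t (WK _ wW) (tK _ tt) (Wt _ _ wW tt).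
  by rewrite (negPf (BE _ _ wB tt)).
have xt : x \in [:: x; y; z] by rewrite !inE eqxx.
have yt : y \in [:: x; y; z] by rewrite !inE eqxx orbT.
have zt : z \in [:: x; y; z] by rewrite !inE eqxx !orbT.
case: (boolP [exists b in B, exists a in W :\: B, e b a]) => [|noBA].
  case/exists_inP=> b bB /exists_inP[a aA ba].
  have bW : b \in W by move: bB; rewrite inE => /andP[].
  have aW : a \in W by move: aA; rewrite inE => /andP[].
  exists b, a, x, y; split.
  - by split=> //; apply: WK.
  - rewrite /= !inE !negb_or xy.
    rewrite (Wt b x) ?(Wt b y) ?(Wt a x) ?(Wt a y) //= !andbT.
    by apply: contraTneq aA => <-; rewrite inE bB.
  - by split=> //; [apply: At | apply: Bt].
have {}noBA b a : b \in B -> a \in W :\: B -> ~~ e b a.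
  move=> bB aA; apply: contra noBA => ba.
  by apply/exists_inP; exists b => //; apply/exists_inP; exists a.
(* Without such an arc no arc enters W, if B is empty, or K :\: B, if not. *)
have xB : x \notin B by rewrite !inE eqxx andbF.
have xW : x \notin W by rewrite !inE eqxx andbF.
case: (set_0Vmem B) => [B0|[b bB]].
  have [w wW] : exists w, w \in W.
    apply/card_gt0P; have : #|K :\: W| <= 3.
      apply: leq_trans (card_size [:: x; y; z]); apply: subset_leq_card.
      apply/subsetP => t; rewrite inE => /andP[/negPf tW /KE].
      by rewrite tW orbF.
    move=> le3; apply: leq_trans (subset_leq_card (subsetIr K W)).
    rewrite lt0n; apply: contraTneq K4 => KW0.
    by rewrite -(cardsID W K) KW0 -leqNgt.
  case: (cut W).
  - apply/properP; split; first by apply/subsetP => t /WK.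
    by exists x.
  - by apply/set0Pn; exists w.
  move=> a [t []] aW tK' /negPf tW ta; have := KE t tK'; rewrite tW orbF => tt.
  by have := AE a t _ tt; rewrite B0 setD0 ta => /(_ aW).
case: (cut (K :\: B)).
- apply/properP; split; first by apply: subsetDl.
  exists b; last by rewrite inE bB.
  by apply: WK; move: bB; rewrite inE => /andP[].
- by apply/set0Pn; exists x; rewrite inE xB.
move=> a [b' []]; rewrite inE => /andP[aB aK] bK.
rewrite inE bK andbT negbK => bB' ba.
case/orP: (KE a aK) => [at'|aW].
  by have := BE b' a bB' at'; rewrite ba.
have aA : a \in W :\: B by rewrite inE aB.
by have := noBA b' a bB' aA; rewrite ba.
Qed.

(** A minimal nonempty set that receives no arc from the rest of [K] is strong:
    a cut of it without arcs would give a smaller such set. *)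
Lemma small_source (T : finType) (e : rel T) (K : {set T}) :
  K != set0 -> semicomplete_on e K -> ~ has_4cycle e K ->
  exists2 S : {set T}, S \subset K & [/\ S != set0, #|S| <= 3 &
     forall x y, x \in S -> y \in K -> y \notin S -> ~~ e y x].
Proof.
move=> K0 tot no4.
pose closed (X : {set T}) := [&& X != set0, X \subset K &
  [forall x in X, forall y in K :\: X, ~~ e y x]].
have cK : closed K.
  rewrite /closed K0 subxx; apply/forall_inP => x _; apply/forall_inP => y.
  by rewrite setDv inE.
have [S /minsetP[/and3P[S0 SK /forall_inP cS] minS] _] := minset_exists cK.
exists S => //; split => //; last first.
  by move=> x y xS yK yS; move/(_ x xS)/forall_inP: cS; apply; rewrite inE yS.
rewrite leqNgt; apply/negP => S4; apply: no4.
suff [x [y [z [w [[xS yS zS wS] U E]]]]] : has_4cycle e S.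
  by exists x, y, z, w; split => //; split; apply: (subsetP SK).
apply: strong_4cycle S4; first by apply: sub_in2 tot; apply/subsetP.
move=> X XS X0; have XSs := proper_sub XS.
have : ~~ closed X.
  by apply/negP => /minS /(_ XSs) XE; rewrite XE properxx in XS.
rewrite /closed X0 (subset_trans XSs SK) => /forall_inPn[x xX].
case/forall_inPn=> y; rewrite inE negbK => /andP[yX yK] yx.
exists x, y; split=> //; apply: contraTT yx => yS.
by move/(_ x (subsetP XSs x xX))/forall_inP: cS; apply; rewrite inE yS.
Qed.

(** * Digraphs without R4 *)

Lemma containsP (D H : digraph) :
  reflect (exists2 f : H -> D, injective f &
             forall x y, has_arc x y -> has_arc (f x) (f y))
          (contains D H).
Proof.
apply: (iffP existsP) => [[f]|[f f_inj fP]].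
  case/andP=> /injectiveP f_inj /forallP fP.
  by exists f => // x y; apply/implyP; move/forallP: (fP x); apply.
exists [ffun x => f x]; apply/andP; split.
  by apply/injectiveP => x y; rewrite !ffunE => /f_inj.
by apply/forallP => x; apply/forallP => y; rewrite !ffunE; apply/implyP/fP.
Qed.

Lemma R4_tournament (x y : R4) : x != y -> has_arc x y || has_arc y x.
Proof. by case: x y => [[|[|[|[|//]]]] ?] [[|[|[|[|//]]]] ?]. Qed.

Lemma R4_out (x : R4) : exists y : R4, has_arc x y.
Proof.
by case: x => [[|[|[|[|//]]]] ?];
  [ exists (@Ordinal 4 1 isT) | exists (@Ordinal 4 2 isT)
  | exists (@Ordinal 4 3 isT) | exists (@Ordinal 4 0 isT)].
Qed.

(** A homomorphism never identifies two vertices of a tournament, because they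
    are adjacent and the target is loopless. *)
Lemma free_hom (D D' : digraph) (s : D' -> D) :
  (forall x y, has_arc x y -> has_arc (s x) (s y)) ->
  is_free R4 D -> is_free R4 D'.
Proof.
move=> sP; apply: contra => /containsP[f f_inj fP]; apply/containsP.
exists (s \o f) => [x y /= sxy|x y xy]; last by apply/sP/fP.
apply/eqP/contraT => /R4_tournament /orP[] /fP /sP; by rewrite sxy arc_irr.
Qed.

Lemma pullback_irr (D : digraph) (T : finType) (s : T -> D) :
  irreflexive (fun x y => has_arc (s x) (s y)).
Proof. by move=> x; apply: arc_irr. Qed.

(** The one construction behind cloning and induced subdigraphs: [s] says which
    vertex of [D] each new vertex copies. *)
Definition pullback (D : digraph) (T : finType) (s : T -> D) : digraph :=
  Digraph (pullback_irr s).

Lemma pullback_free (D : digraph) (T : finType) (s : T -> D) :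
  is_free R4 D -> is_free R4 (pullback s).
Proof. exact: (@free_hom D (pullback s) s). Qed.

Lemma outdegE (D : digraph) (x : D) : outdeg x = \sum_(y : D) has_arc x y.
Proof.
rewrite /outdeg -sum1_card big_mkcond; apply: eq_bigr => y _.
by rewrite inE; case: has_arc.
Qed.

Lemma iso_free (D D' : digraph) :
  isomorphic D D' -> is_free R4 D = is_free R4 D'.
Proof.
case=> f [g fK gK] fP; apply/idP/idP; last first.
  by apply: (@free_hom _ _ f) => x y; rewrite fP.
by apply: (@free_hom _ _ g) => x y; rewrite -fP !gK.
Qed.

Lemma iso_sqnorm (D D' : digraph) :
  isomorphic D D' -> outdeg_sqnorm D = outdeg_sqnorm D'.
Proof.
case=> f f_bij fP; rewrite /outdeg_sqnorm [RHS](reindex f) /=;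
  last exact: onW_bij.
apply: eq_bigr => x _; congr (_ ^ 2); rewrite !outdegE [RHS](reindex f) /=;
  last exact: onW_bij.
by apply: eq_bigr => y _; rewrite fP.
Qed.

Lemma iso_ord (D : digraph) :
  exists A : {set 'I_(nvertices D) * 'I_(nvertices D)},
    isomorphic (digraph_of A) D.
Proof.
exists [set p | has_arc (enum_val p.1 : D) (enum_val p.2)].
exists (enum_val : 'I__ -> D); first by apply: enum_val_bij.
move=> x y; rewrite /= /digraph_of_rel inE /=.
by case: eqVneq => [->|] //=; rewrite arc_irr.
Qed.

Lemma nvertices_ord n (A : {set 'I_n * 'I_n}) : nvertices (digraph_of A) = n.
Proof. exact: card_ord. Qed.

Lemma exL2_extremal (D : digraph) : extremal R4 D ->
  exL2 (nvertices D) R4 = outdeg_sqnorm D.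
Proof.
case=> fD maxD; apply/eqP; rewrite eqn_leq; apply/andP; split.
  by apply/bigmax_leqP => A fA; apply: maxD => //; apply: nvertices_ord.
have [A isoA] := iso_ord D; rewrite -(iso_sqnorm isoA).
by apply: (bigmax_sup A); rewrite ?(iso_free isoA).
Qed.

Lemma extremal_exists n : exists2 D, nvertices D = n & extremal R4 D.
Proof.
pose F (A : {set 'I_n * 'I_n}) := outdeg_sqnorm (digraph_of A).
have free0 : is_free R4 (digraph_of (set0 : {set 'I_n * 'I_n})).
  apply/negP => /containsP[f _ fP]; have [y] := R4_out (@ord0 3).
  by move/fP; rewrite /= /digraph_of_rel inE andbF.
have [A fA maxA] :=
  arg_maxnP (P := fun A => is_free R4 (digraph_of A)) F free0.
exists (digraph_of A); first exact: nvertices_ord.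
split=> // D; rewrite nvertices_ord => Dn; have [B isoB] := iso_ord D.
move: B isoB; rewrite Dn => B isoB.
by rewrite -(iso_free isoB) -(iso_sqnorm isoB) => /maxA.
Qed.

(** Whatever the orientation of the two chords, a rotation of the 4-cycle
    turns them into the chords [u1 u3] and [u2 u4]. *)
Lemma R4_free_no_4cycle (D : digraph) (K : {set D}) :
  is_free R4 D -> semicomplete_on (@has_arc D) K ->
  ~ has_4cycle (@has_arc D) K.
Proof.
move=> fD tot.
have key (x y z w : D) : uniq [:: x; y; z; w] ->
    has_arc x y -> has_arc y z -> has_arc z w -> has_arc w x ->
    has_arc x z -> has_arc y w -> False.
  move=> U xy yz zw wx xz yw; move/negP: fD; apply; apply/containsP.
  exists (fun i : 'I_4 => nth x [:: x; y; z; w] i) => [i j /eqP|i j].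
    by rewrite nth_uniq // => /eqP/val_inj.
  by case: i j => [[|[|[|[|//]]]] ?] [[|[|[|[|//]]]] ?].
case=> x [y [z [w [[xK yK zK wK] U [xy yz zw wx]]]]].
have rot1 (a b c d : D) : uniq [:: a; b; c; d] -> uniq [:: b; c; d; a].
  by rewrite -(rot_uniq 1).
have nxz : x != z by move: U; rewrite /= !inE !negb_or => /andP[/and3P[]].
have nyw : y != w by move: U; rewrite /= !inE !negb_or => /and3P[_ /andP[]].
case/orP: (tot x z xK zK nxz) => xz; case/orP: (tot y w yK wK nyw) => yw.
- exact: (key x y z w).
- by apply: (key w x y z) => //; apply/rot1/rot1/rot1.
- by apply: (key y z w x) => //; apply: rot1.
- by apply: (key z w x y) => //; apply/rot1/rot1.
Qed.

(** * Symmetrization *)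

Definition nonadjacent (D : digraph) (x y : D) : bool :=
  ~~ has_arc x y && ~~ has_arc y x.

Definition clone (D : digraph) (u v : D) : digraph :=
  pullback (fun x : D => if x == u then v else x).

(** Only the terms of [u] and of the vertices dominating exactly one of [u] and
    [v] change. The subtraction is exact: a vertex dominating [u] has positive
    out-degree. *)
Lemma sqnorm_clone (D : digraph) (u v : D) : nonadjacent u v ->
  outdeg_sqnorm (clone u v) + outdeg u ^ 2 =
  \sum_(x : D) (outdeg x + has_arc x v - has_arc x u) ^ 2 + outdeg v ^ 2.
Proof.
case/andP=> /negPf uv /negPf vu.
pose g (x : D) := outdeg x + has_arc x v - has_arc x u.
have gE (x : D) : \sum_(y : D) has_arc x (if y == u then v else y) = g x.
  rewrite /g outdegE (bigD1 u) //= [in RHS](bigD1 u) //= eqxx.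
  rewrite -addnA addKn addnC; congr (_ + _).
  by apply: eq_bigr => y /negPf ->.
have gv : g v = outdeg v by rewrite /g arc_irr vu addn0 subn0.
have gu : g u = outdeg u by rewrite /g arc_irr uv addn0 subn0.
rewrite [RHS](_ : _ = \sum_x g x ^ 2 + outdeg v ^ 2) //.
rewrite {1}/outdeg_sqnorm (bigD1 u) //= [in RHS](bigD1 u) //= gu.
rewrite outdegE /= eqxx gE gv [RHS]addnC addnA addnAC; congr (_ + _ + _).
by apply: eq_bigr => x /negPf xu; rewrite outdegE /= xu gE.
Qed.

(** Replacing [u] by a copy of [v], and [v] by a copy of [u], gives two
    [R4]-free digraphs whose norms add up to twice the norm of [D] plus twice
    the number of vertices dominating exactly one of [u] and [v]. Neither norm
    exceeds that of [D], so there is no such vertex, and then the terms of [u]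
    and [v] must agree too. *)
Lemma extremal_twins (D : digraph) (u v : D) : extremal R4 D ->
  nonadjacent u v ->
  outdeg u = outdeg v /\ forall x : D, has_arc x u = has_arc x v.
Proof.
move=> [fD maxD] uv.
have vu : nonadjacent v u by rewrite /nonadjacent andbC.
have Cuv : outdeg_sqnorm (clone u v) <= outdeg_sqnorm D.
  by apply: maxD => //; apply: pullback_free.
have Cvu : outdeg_sqnorm (clone v u) <= outdeg_sqnorm D.
  by apply: maxD => //; apply: pullback_free.
have Suv := sqnorm_clone uv; have Svu := sqnorm_clone vu.
have sumE : \sum_(x : D) (outdeg x + has_arc x v - has_arc x u) ^ 2
    + \sum_(x : D) (outdeg x + has_arc x u - has_arc x v) ^ 2
    = (outdeg_sqnorm D).*2
      + (\sum_(x : D) (has_arc x u != has_arc x v)).*2.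
  rewrite /outdeg_sqnorm -!muln2 !big_distrl /= -!big_split /=.
  apply: eq_bigr => x _.
  have : has_arc x u <= outdeg x by rewrite outdegE (bigD1 u) //= leq_addr.
  have : has_arc x v <= outdeg x by rewrite outdegE (bigD1 v) //= leq_addr.
  case: (has_arc x u); case: (has_arc x v) => /=; move: (outdeg x) => d;
    by rewrite ?addnK ?addn0 ?subn0; case: d => // d; lia.
have /eqP : \sum_(x : D) (has_arc x u != has_arc x v) = 0 by lia.
rewrite sum_nat_eq0 => /forallP E0.
have in_eq x : has_arc x u = has_arc x v.
  by apply/eqP; have := E0 x; rewrite eqb0 negbK.
split=> //.
have same (s t : D) : (forall x, has_arc x s = has_arc x t) ->
    \sum_(x : D) (outdeg x + has_arc x s - has_arc x t) ^ 2 = outdeg_sqnorm D.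
  by move=> st; apply: eq_bigr => x _; rewrite st addnK.
rewrite same // in Suv; rewrite same // in Svu.
by apply/eqP; rewrite -(eqn_exp2r _ _ (isT : 0 < 2)); apply/eqP; lia.
Qed.

(** Nonadjacency is transitive because nonadjacent vertices have the same
    in-neighbours: if [y] is adjacent to neither [x] nor [z], then an arc
    [xz] would give an arc [xy], and [zx] would give [zy]. The map [r] picks
    a representative in each class. *)
Lemma extremal_classes (D : digraph) : extremal R4 D ->
  exists r : D -> D,
    [/\ forall x y, (r x == r y) = nonadjacent x y,
        forall x y : D, has_arc x (r y) = has_arc x y,
        forall x, outdeg (r x) = outdeg x & forall x, r (r x) = r x].
Proof.
move=> exD; have twin := @extremal_twins D _ _ exD.
have nC x y : @nonadjacent D x y = nonadjacent y x.
  by rewrite /nonadjacent andbC.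
have nT x y z : @nonadjacent D x y -> nonadjacent y z -> nonadjacent x z.
  move=> xy yz; rewrite /nonadjacent.
  have [_ <-] := twin _ _ yz; have [_ ->] := twin _ _ xy.
  by case/andP: xy => -> _; case/andP: yz => _ ->.
have nR x : @nonadjacent D x x by rewrite /nonadjacent arc_irr.
pose r (x : D) := odflt x [pick y | nonadjacent x y].
have nr x : nonadjacent x (r x).
  by rewrite /r; case: pickP => //= /(_ x); rewrite nR.
have rE x y : nonadjacent x y -> r x = r y.
  move=> xy; rewrite /r (@eq_pick _ _ (nonadjacent y)) => [|z].
    by case: pickP => //= /(_ y); rewrite nR.
  by apply/idP/idP; apply: nT; rewrite // nC.
exists r; split=> [x y|x y|x|x].
- apply/eqP/idP => [rxy|]; last exact: rE.
  by apply: (nT _ _ _ (nr x)); rewrite rxy nC.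
- by case: (twin _ _ (nr y)) => _ ->.
- by case: (twin _ _ (nr x)).
- by rewrite -(rE x (r x)).
Qed.

(** * Coloured digraphs *)

Definition fibre (T : finType) (c : T -> nat) i := #|[set x | c x == i]|.

Lemma sum_by_colour (T : finType) (c : T -> nat) (G : nat -> nat) :
  (forall x, c x < 4) ->
  \sum_(x : T) G (c x) =
  fibre c 0 * G 0 + fibre c 1 * G 1 + fibre c 2 * G 2 + fibre c 3 * G 3.
Proof.
move=> c4; have fibreE i : fibre c i = \sum_(x : T) (c x == i).
  rewrite /fibre -sum1_card big_mkcond; apply: eq_bigr => x _.
  by rewrite inE; case: eqP.
rewrite !fibreE !big_distrl -!big_split; apply: eq_bigr => x _ /=.
by case: (c x) (c4 x) => [|[|[|[|//]]]] _ /=; rewrite ?mul0n ?mul1n ?addn0.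
Qed.

Lemma card_by_colour (T : finType) (c : T -> nat) :
  (forall x, c x < 4) ->
  #|T| = fibre c 0 + fibre c 1 + fibre c 2 + fibre c 3.
Proof. by move/(sum_by_colour (fun=> 1)); rewrite sum1_card !muln1. Qed.

(** Send the [k]-th element of each fibre of [c] to the [k]-th element of the
    fibre of [c'] with the same colour. *)
Lemma colour_bij (T T' : finType) (c : T -> nat) (c' : T' -> nat) :
  (forall i, fibre c i = fibre c' i) -> #|T| = #|T'| ->
  exists2 f : T -> T', bijective f & forall x, c' (f x) = c x.
Proof.
move=> cE TE; have [T0|[t0 _]] := set_0Vmem [set: T].
  have noT (x : T) : False by have := in_setT x; rewrite T0 inE.
  exists (fun x => match noT x with end) => [|x]; last by case: (noT x).
  by apply: inj_card_bij => [x|]; [case: (noT x) | rewrite TE].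
pose A i := [set x : T | c x == i]; pose B i := [set y : T' | c' y == i].
have iB x : index x (enum (A (c x))) < size (enum (B (c x))).
  rewrite -cardE -[#|_|]/(fibre c' (c x)) -cE /fibre cardE.
  by rewrite index_mem mem_enum inE.
have [y0 _] : exists y : T', y \in T'.
  by apply/card_gt0P; rewrite -TE; apply/card_gt0P; exists t0.
pose f x := nth y0 (enum (B (c x))) (index x (enum (A (c x)))).
have fc x : c' (f x) = c x.
  have : f x \in enum (B (c x)) by apply: mem_nth.
  by rewrite mem_enum inE => /eqP.
exists f => //; apply: inj_card_bij; last by rewrite TE.
move=> x y fxy; have cxy : c x = c y by rewrite -!fc fxy.
have := iB y; have := iB x; move: fxy; rewrite /f cxy => /eqP fxy ix iy.
move: fxy; rewrite nth_uniq ?enum_uniq // => /eqP /(index_inj t0); apply;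
  by rewrite mem_enum inE ?cxy.
Qed.

(** The arcs of [E m] in terms of colours: 0, 1 and 2 are the three parts, and
    3 marks the vertex that may remain, which has no out-neighbour. *)
Definition coloured (D : digraph) (c : D -> nat) :=
  (forall x, c x < 4) /\
  forall x y, has_arc x y = (c x != c y) && (c x != 3).

(** The vertices of a copy of [R4] are pairwise adjacent, so they receive all
    four colours, and the one of colour 3 has an out-neighbour in [R4]. *)
Lemma coloured_free (D : digraph) (c : D -> nat) :
  coloured c -> is_free R4 D.
Proof.
case=> c4 cE; apply/negP => /containsP[f _ fP].
pose g (i : 'I_4) := Ordinal (c4 (f i)).
have g_inj : injective g.
  move=> i j gij; apply/eqP/contraT => /R4_tournament.
  have cij : c (f i) = c (f j) by have := congr1 val gij.
  by case/orP => /fP; rewrite cE cij eqxx.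
have /codomP[i iE] := injF_onto g_inj (@ord_max 3).
have [j /fP] := R4_out i; rewrite cE.
by have /= <- := congr1 val iE; rewrite andbF.
Qed.

Lemma coloured_outdeg (D : digraph) (c : D -> nat) (x : D) : coloured c ->
  outdeg x = if c x == 3 then 0 else nvertices D - fibre c (c x).
Proof.
case=> _ cE; case: eqP => [c3|/eqP c3].
  by apply: eq_card0 => y; rewrite inE cE c3 andbF.
rewrite /nvertices /fibre -cardsT -cardsDS ?subsetT //; apply: eq_card => y.
by rewrite !inE cE c3 eq_sym.
Qed.

Lemma coloured_sqnorm (D : digraph) (c : D -> nat) :
  coloured c -> let m := nvertices D in
  outdeg_sqnorm D = parts_weight m (fibre c 0) + parts_weight m (fibre c 1)
                    + parts_weight m (fibre c 2).
Proof.
move=> Dc m; have [c4 _] := Dc.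
pose G i := (if i == 3 then 0 else m - fibre c i) ^ 2.
rewrite /outdeg_sqnorm (eq_bigr (fun x => G (c x))) => [|x _].
  by rewrite sum_by_colour // muln0 addn0.
by rewrite (coloured_outdeg _ Dc).
Qed.

Lemma coloured_iso (D D' : digraph) (c : D -> nat) (c' : D' -> nat) :
  coloured c -> coloured c' -> nvertices D = nvertices D' ->
  (forall i, i < 3 -> fibre c i = fibre c' i) -> isomorphic D D'.
Proof.
move=> [c4 cE] [c4' cE'] nE fE.
have [||f f_bij fc] := @colour_bij D D' c c'; last 1 first.
- by exists f => // x y; rewrite cE cE' !fc.
- case=> [|[|[|[|i]]]]; [exact: fE..| |].
    move: nE; rewrite /nvertices (card_by_colour c4) (card_by_colour c4').
    rewrite (fE 0) // (fE 1) // (fE 2) //.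
    exact: addnI.
  rewrite /fibre !eq_card0 // => x; rewrite inE; apply/negbTE.
    by have := c4' x; apply: contraTneq => ->.
  by have := c4 x; apply: contraTneq => ->.
- exact: nE.
Qed.

Lemma card_residue k i : i < 3 ->
  #|[set x : 'I_k | x %% 3 == i]| = (k + 2 - i) %/ 3.
Proof.
move=> i3; rewrite -sum1_card big_mkcond.
rewrite (eq_bigr (fun x : 'I_k => (x %% 3 == i) : nat)).
  elim: k => [|k IHk]; first by rewrite big_ord0; lia.
  by rewrite big_ord_recr /= IHk; case: eqP; lia.
by move=> x _; rewrite inE; case: eqP.
Qed.

Lemma E_coloured m : 0 < m ->
  nvertices (E m) = m /\
  exists2 c : E m -> nat,
    coloured c & forall i, i < 3 -> fibre c i = E_part m i.
Proof.
move=> m0; rewrite /E; set k := (if _ then _ else _).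
have kE : k = m - (m %% 3 == 1) by rewrite /k; case: eqP => _; lia.
have km : k <= m by lia.
split; first by rewrite /nvertices /= card_sum !card_ord subnKC.
pose c (x : djoin (T3 k) (TT (m - k))) :=
  match x with inl a => val a %% 3 | inr _ => 3 end.
exists c => [|i i3].
  split=> [[a|b] //=|]; first exact: (ltn_trans (ltn_pmod _ _)).
  case=> [a|b] [a'|b'] //=.
  - by rewrite /T3_rel [a %% 3 == 3]ltn_eqF ?ltn_mod // andbT.
  - by rewrite [a %% 3 == 3]ltn_eqF ?ltn_mod.
  - by rewrite andbF.
  - by rewrite /TT_rel; case: b b' => [b ?] [b' ?] /=; lia.
rewrite /E_part -kE -card_residue // /fibre.
rewrite -[RHS](card_imset _ (@inl_inj _ (TT (m - k)))).
apply: eq_card => -[a|b]; rewrite inE /=.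
  by rewrite mem_imset ?inE //; apply: inl_inj.
apply/idP/imsetP => [|[a _ //]].
by move/eqP => i3'; rewrite -i3' in i3.
Qed.

(** * The structure of extremal digraphs *)

(** Colours 0, 1 and 2 are given to the nonadjacency classes whose
    representatives form the source [S] of [small_source], in decreasing order
    of size, and colour 3 to all other vertices. A vertex and
    its representative may have different out-neighbours, so [D] itself may have
    arcs from colour 3 back to the source. In the digraph where each vertex
    copies its representative there are none, and that digraph has the
    out-degrees of [D], which are constant on classes; [D'] is its restriction
    to colour 3. *)
Lemma extremal_colouring (D : digraph) : extremal R4 D -> 0 < nvertices D ->
  exists c : D -> nat,
    [/\ forall x, c x < 4, fibre c 2 <= fibre c 1 <= fibre c 0, 0 < fibre c 0,
        forall x y, c x != 3 -> has_arc x y -> c y != c x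
      & exists D', [/\ nvertices D' = fibre c 3, is_free R4 D' &
          \sum_(x | c x == 3) outdeg x ^ 2 = outdeg_sqnorm D']].
Proof.
move=> exD; case/card_gt0P => x0 _.
have [r [rE arc_r outdeg_r rr]] := extremal_classes exD.
pose T : {set D} := [set x | r x == x].
have rT x : r x \in T by rewrite inE rr.
have T0 : T != set0 by apply/set0Pn; exists (r x0).
have Ttot : semicomplete_on (@has_arc D) T.
  move=> x y; rewrite !inE => /eqP rx /eqP ry; rewrite -{1}rx -{1}ry.
  by rewrite rE /nonadjacent negb_and !negbK.
have no4 := R4_free_no_4cycle (proj1 exD) Ttot.
have [S ST [S0 S3 Ssource]] := small_source T0 Ttot no4.
pose n t := #|[set x | r x == t]|.
pose s := sort (fun t u => n u <= n t) (enum S).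
have s_sz : size s <= 3 by rewrite size_sort -cardE.
have s_mem t : (t \in s) = (t \in S) by rewrite mem_sort mem_enum.
have s_uniq : uniq s by rewrite sort_uniq enum_uniq.
have s_sorted : sorted (fun t u => n u <= n t) s.
  by apply: sort_sorted => t u; apply: leq_total.
pose c (x : D) := if r x \in S then index (r x) s else 3.
have c4 x : c x < 4.
  rewrite /c; case: ifP => // rxS; apply: (@leq_ltn_trans (size s)) => //.
  exact: index_size.
have c3 x : (c x == 3) = (r x \notin S).
  rewrite /c; case: ifP => // rxS; apply: ltn_eqF; apply: leq_trans s_sz.
  by rewrite index_mem s_mem.
have fibreE i : i < 3 -> fibre c i = nth 0 (map n s) i.
  move=> i3; have [si|si] := ltnP i (size s).
    rewrite (nth_map x0) // /n; apply: eq_card => x; rewrite !inE /c.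
    case: ifP => rxS; last first.
      rewrite gtn_eqF //; apply/esym/eqP => rxE.
      by rewrite rxE -s_mem mem_nth in rxS.
    by rewrite -(nth_uniq x0 _ si s_uniq) ?index_mem ?nth_index ?s_mem.
  rewrite nth_default ?size_map //; apply: eq_card0 => x; rewrite !inE /c.
  case: ifP => rxS; last exact: gtn_eqF.
  by apply/ltn_eqF/(leq_trans _ si); rewrite index_mem s_mem.
have [t tS] := set0Pn _ S0.
have nt0 : 0 < n t.
  apply/card_gt0P; exists t; rewrite inE.
  by have := subsetP ST t tS; rewrite inE.
exists c; split => //.
- rewrite !fibreE //; move: s_sz s_sorted; clear.
  case: s => [|a [|b [|d [|]]]] //= _; rewrite ?andbT ?leqnn //.
  by case/andP => -> ->.
- rewrite fibreE //; have ts : t \in s by rewrite s_mem.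
  move: s_sorted ts; case: (s) => [|a s'] //= pth; rewrite inE.
  case/orP => [/eqP <- //|ts]; apply: (leq_trans nt0).
  have /allP := order_path_min (fun _ _ _ h1 h2 => leq_trans h2 h1) pth.
  by apply.
- move=> x y cx xy; apply/eqP => cxy.
  have : r x == r y.
    have rxS : r x \in S by move: cx; rewrite c3 negbK.
    have ryS : r y \in S by move: cx; rewrite -cxy c3 negbK.
    move: cxy; rewrite /c rxS ryS => ixy.
    by rewrite -[r x](nth_index x0 (s := s)) ?s_mem // -ixy nth_index ?s_mem.
  by rewrite rE /nonadjacent xy.
pose sub := pullback (fun z : {x : D | r x \notin S} => r (val z)).
exists sub; split.
- rewrite /nvertices /fibre card_sig -cardsE; apply: eq_card => x.
  by rewrite !inE c3.
- exact/pullback_free/(proj1 exD).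
rewrite /outdeg_sqnorm (eq_bigl (fun x => r x \notin S)) //=.
rewrite (big_sub (fun x => r x \notin S)); apply: eq_bigr => z _.
congr (_ ^ 2); rewrite -outdeg_r [RHS]outdegE outdegE /=.
rewrite (bigID (fun y => r y \in S)) /= big1 ?add0n => [|y ryS].
  rewrite (big_sub (fun x => r x \notin S)); apply: eq_bigr => y _.
  by rewrite arc_r.
rewrite -arc_r; apply/eqP; rewrite eqb0.
by apply: (Ssource (r y) (r (val z))) => //; apply: (valP z).
Qed.

(** Equality forces the class sizes, and also that every vertex of colour 0, 1
    or 2 dominates all vertices of other colours. At most one vertex has
    colour 3, and its out-degree is 0 since [R4_bound] vanishes at 1. *)
Lemma extremal_step (D : digraph) : let m := nvertices D in
  extremal R4 D -> 0 < m ->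
  (forall D', nvertices D' < m -> is_free R4 D' ->
     outdeg_sqnorm D' <= R4_bound (nvertices D')) ->
  outdeg_sqnorm D <= R4_bound m /\
  (outdeg_sqnorm D = R4_bound m -> m != 1 ->
   exists2 c : D -> nat,
     coloured c & forall i, i < 3 -> fibre c i = E_part m i).
Proof.
move=> m exD m0 IH.
have [c [c4 /andP[c21 c10] c0 c_arc [D' [D'n fD' D'sq]]]] :=
  extremal_colouring exD m0.
have mE : m = fibre c 0 + fibre c 1 + fibre c 2 + fibre c 3.
  exact: card_by_colour.
have D'le : outdeg_sqnorm D' <= R4_bound (fibre c 3).
  by rewrite -D'n; apply: IH => //; rewrite D'n mE; lia.
have deg_le x : c x != 3 -> outdeg x <= m - fibre c (c x).
  move=> cx; rewrite /m /nvertices /fibre -cardsT -cardsDS ?subsetT //.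
  apply: subset_leq_card; apply/subsetP => y.
  by rewrite !inE andbT; apply: c_arc.
pose G i := if i == 3 then 0 else (m - fibre c i) ^ 2.
have sumG : \sum_(x | c x != 3) (m - fibre c (c x)) ^ 2 =
    parts_weight m (fibre c 0) + parts_weight m (fibre c 1)
    + parts_weight m (fibre c 2).
  rewrite big_mkcond (eq_bigr (fun x => G (c x))) => [|x _]; last first.
    by rewrite /G; case: eqP.
  by rewrite sum_by_colour // muln0 addn0.
have sqE : outdeg_sqnorm D =
    \sum_(x | c x != 3) outdeg x ^ 2 + outdeg_sqnorm D'.
  rewrite -D'sq /outdeg_sqnorm (bigID (fun x => c x != 3)) /=; congr (_ + _).
  by apply: eq_bigl => x; rewrite negbK.
have [le1 le1E] := leqif_sum (fun x (cx : c x != 3) =>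
  leqif_eq (eq_ind_r is_true (deg_le x cx) (leq_exp2r _ _ (isT : 0 < 2)))).
have k0 : 0 < fibre c 0 + fibre c 1 + fibre c 2 by lia.
have := parts_bound (fibre c 3) k0; cbv zeta; rewrite -mE -sumG => -[le2 eq2].
split=> [|FE m1]; first by lia.
have [||//|p0 p1 p2] := eq2; [by lia | by rewrite c21 c10 | ].
exists c; last by case=> [|[|[|//]]].
split=> // x y.
have eq1 : \sum_(x | c x != 3) outdeg x ^ 2 ==
    \sum_(x | c x != 3) (m - fibre c (c x)) ^ 2.
  by apply/eqP; lia.
case: (eqVneq (c x) 3) => [cx|cx]; rewrite ?andbF ?andbT.
  have c31 : fibre c 3 <= 1 by move: mE p0 p1 p2; rewrite /E_part; lia.
  have : R4_bound (fibre c 3) = 0 by case: (fibre c 3) c31 => [|[|]].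
  move=> R0; have : outdeg_sqnorm D' = 0 by lia.
  rewrite -D'sq => /eqP; rewrite sum_nat_eq0 => /forall_inP /(_ x).
  rewrite cx expn_eq0 andbT => /(_ isT); rewrite cards_eq0 => /eqP/setP/(_ y).
  by rewrite !inE.
move: eq1; rewrite le1E => /forall_inP/(_ x cx).
rewrite eqn_exp2r // => /eqP dx.
pose B := [set y | c y != c x].
have NB : [set w | has_arc x w] \subset B.
  by apply/subsetP => w; rewrite !inE; apply: c_arc.
have /setP/(_ y) : [set w | has_arc x w] = B.
  apply/eqP; rewrite eqEcard NB /= -/(outdeg x) dx /m /nvertices /fibre -cardsT.
  rewrite -cardsDS ?subsetT //; apply: subset_leq_card.
  by apply/subsetP => w; rewrite !inE andbT.
by rewrite !inE eq_sym.
Qed.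

(** Every [R4]-free digraph is compared with an extremal one of the same order,
    to which the induction step applies. *)
Lemma R4_free_bound (D : digraph) :
  is_free R4 D -> outdeg_sqnorm D <= R4_bound (nvertices D).
Proof.
have [n] := ubnP (nvertices D); elim: n D => // n IH D Dn fD.
have [D0|m0] := posnP (nvertices D).
  rewrite /outdeg_sqnorm big1 // => x _.
  by have /eqP := D0; rewrite /nvertices => /eqP/card0_eq/(_ x).
have [M Mn exM] := extremal_exists (nvertices D).
have FDM : outdeg_sqnorm D <= outdeg_sqnorm M by apply: (proj2 exM).
rewrite -Mn in m0 Dn *; apply: leq_trans FDM _.
by apply: (proj1 (extremal_step exM m0 _)) => D' lt fD'; apply: IH => //; lia.
Qed.

(** * The theorem *)

Lemma E_sqnorm m : 0 < m -> outdeg_sqnorm (E m) = R4_bound m.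
Proof.
move=> m0; have [En [c Ec cE]] := E_coloured m0.
by rewrite (coloured_sqnorm Ec) En !cE // R4_bound_E.
Qed.

Lemma E_extremal m : 0 < m -> extremal R4 (E m).
Proof.
move=> m0; have [En [c Ec _]] := E_coloured m0.
split; first exact: coloured_free Ec.
move=> D' D'n fD'; rewrite E_sqnorm // -[X in R4_bound X]En -D'n.
exact: R4_free_bound.
Qed.

Lemma one_vertex_iso (D D' : digraph) :
  nvertices D = 1 -> nvertices D' = 1 -> isomorphic D D'.
Proof.
move=> D1 D1'.
have const (B : digraph) : nvertices B = 1 -> coloured (fun _ : B => 3).
  move=> B1; split=> // x y.
  by rewrite (fintype_le1P _ x y) ?arc_irr // -[#|_|]/(nvertices B) B1.
apply: (coloured_iso (const _ D1) (const _ D1')); first by rewrite D1.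
by move=> i i3; rewrite /fibre !eq_card0 // => x; rewrite inE gtn_eqF.
Qed.

Lemma extremal_iso_E (D : digraph) : 0 < nvertices D -> extremal R4 D ->
  isomorphic D (E (nvertices D)).
Proof.
move=> m0 exD; have [En [c' Ec' cE']] := E_coloured m0.
have [D1|Dn1] := eqVneq (nvertices D) 1.
  by apply: one_vertex_iso; rewrite // En.
have DE : outdeg_sqnorm D = R4_bound (nvertices D).
  apply/eqP; rewrite eqn_leq R4_free_bound ?(proj1 exD) //= -E_sqnorm //.
  by apply: (proj2 exD) => //; apply: (proj1 (E_extremal m0)).
have [D' _|_ eqD] := extremal_step exD m0; first exact: R4_free_bound.
have [c Dc cE] := eqD DE Dn1.
by apply: (coloured_iso Dc Ec') => // i i3; rewrite cE ?cE'.
Qed.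

Theorem theorem3p2 (m : nat) (hm : 1 <= m) :
  [/\ nvertices (E m) = m,
      extremal R4 (E m) &
      forall D : digraph, nvertices D = m -> extremal R4 D -> isomorphic D (E m)]
  /\ (forall q : nat,
      [/\ m = 3 * q -> exL2 m R4 = 12 * q ^ 3,
          m = 3 * q + 1 -> exL2 m R4 = 12 * q ^ 3 + 12 * q ^ 2 + 3 * q &
          m = 3 * q + 2 ->
            exL2 m R4 = 12 * q ^ 3 + 24 * q ^ 2 + 14 * q + 2]).
Proof.
have [En _] := E_coloured hm; have exE := E_extremal hm.
split.
  by split=> // D Dm exD; have := extremal_iso_E _ exD; rewrite Dm; apply.
have exL2E : exL2 m R4 = R4_bound m.
  by rewrite -[in LHS]En exL2_extremal // E_sqnorm.
move=> q; rewrite exL2E; split=> ->.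
- exact: R4_bound0.
- exact: R4_bound1.
- exact: R4_bound2.
Qed.
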